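(* Let $D$ be a finite simple digraph with $UG(D)=K_{1,t}$ for some $t\ge 1$. Then $$F(D)=\begin{cases} t, & \text{if } D \text{ is oriented, or if at least one leaf has in-degree } 0,\\ t-1, & \text{otherwise.}\end{cases}$$
   Context: A finite simple digraph $D=(V,A)$ has finite nonempty vertex set $V$ and arc set $A$ consisting of ordered pairs of distinct vertices (no loops, no parallel arcs; both $(u,v)$ and $(v,u)$ may be present). $N_D^+(v)=\{u:(v,u)\in A\}$, $N_D^-(v)=\{u:(u,v)\in A\}$; the in-degree of $v$ is $|N_D^-(v)|$. $UG(D)$ is the underlying simple undirected graph, obtained by replacing every arc $(u,v)$ by the edge $\{u,v\}$. $K_{1,t}$ is the star with one vertex adjacent to $t$ other vertices and no other edges. $D$ is oriented if $(u,v)\in A$ implies $(v,u)\notin A$. A leaf is a vertex $v$ with $|N_D^+(v)\cup N_D^-(v)|=1$. Zero forcing: for $S\subseteq V$ let $B^0(S)=S$ and $B^{i+1}(S)=B^i(S)\cup\{w:\{w\}=N_D^+(v)\setminus B^i(S)\text{ for some }v\in B^i(S)\}$. $S$ is a zero forcing set (ZFS) if $B^t(S)=V$ for some $t\ge 0$, and a failed zero forcing set (FZFS) otherwise. The failed zero forcing number $F(D)$ is the largest cardinality of an FZFS of $D$. *)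

(* Defs.v *)
From mathcomp Require Import all_boot boolp.

Set Implicit Arguments.
Unset Strict Implicit.
Unset Printing Implicit Defensive.

Record digraph := Digraph {
  vertex :> finType;
  arc : rel vertex;
  vertex_nonempty : 0 < #|vertex|;
  arc_irrefl : irreflexive arc
}.
Arguments arc {d}.

Record sgraph := SGraph {
  svertex :> finType;
  edge : rel svertex;
  edge_sym : symmetric edge;
  edge_irrefl : irreflexive edge
}.
Arguments edge {s}.

Definition sgraph_iso (G H : sgraph) : Prop :=
  exists2 f : G -> H, bijective f & forall u v : G, edge u v = edge (f u) (f v).

Section Star.
Variable t : nat.

Definition star_edge : rel 'I_t.+1 :=
  fun i j => (i == ord0) (+) (j == ord0).

Lemma star_edge_sym : symmetric star_edge.
Proof. by move=> i j; rewrite /star_edge addbC. Qed.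

Lemma star_edge_irrefl : irreflexive star_edge.
Proof. by move=> i; rewrite /star_edge addbb. Qed.

(* K_{1,t}, with centre ord0. *)
Definition star : sgraph := SGraph star_edge_sym star_edge_irrefl.
End Star.

Section Digraph.
Variable D : digraph.
Implicit Types (u v w : D) (S B : {set D}).

Definition out_nbrs v : {set D} := [set u | arc v u].
Definition in_nbrs v : {set D} := [set u | arc u v].
Definition in_degree v : nat := #|in_nbrs v|.
Definition leaf v : bool := #|out_nbrs v :|: in_nbrs v| == 1.

Definition oriented : bool := [forall u : D, forall v : D, arc u v ==> ~~ arc v u].

Definition ug_edge : rel D := fun u v => arc u v || arc v u.

Lemma ug_edge_sym : symmetric ug_edge.
Proof. by move=> u v; rewrite /ug_edge orbC. Qed.

Lemma ug_edge_irrefl : irreflexive ug_edge.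
Proof. by move=> u; rewrite /ug_edge arc_irrefl. Qed.

Definition underlying_graph : sgraph := SGraph ug_edge_sym ug_edge_irrefl.

Definition force_step B : {set D} :=
  B :|: [set w | [exists v in B, [set w] == out_nbrs v :\: B]].

Definition force_iter (i : nat) S : {set D} := iter i force_step S.

Definition zero_forcing S : Prop := exists i : nat, force_iter i S = [set: D].

Definition failed_zero_forcing S : Prop := ~ zero_forcing S.

(* The default value 0 of \max plays no role: set0 is failed, as V is nonempty. *)
Definition failed_zero_forcing_number : nat :=
  \max_(S : {set D} | `[< failed_zero_forcing S >]) #|S|.
End Digraph.

(* Main.v *)
From mathcomp Require Import all_boot boolp.
Require Import Defs.

(** The complement of a single vertex v is a failed set iff v has in-degree 0,
so F(D) = |V| - 1 iff some vertex has in-degree 0.  In a star this vertex is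
either a leaf, or the centre, in which case all arcs leave the centre and D is
oriented; conversely, in an oriented star, either the centre or any leaf with
an arc into it has in-degree 0.  If every in-degree is positive and t >= 2, all
leaves are out-neighbours of the centre, so the complement of two leaves is
stalled: the centre sees two white vertices, and leaves see none. *)

Section ZeroForcing.
Variable D : digraph.
Implicit Types (u v w : D) (S B : {set D}).

Lemma in_degree_eq0P v : reflect (forall u, ~~ arc u v) (in_degree v == 0).
Proof.
rewrite cards_eq0; apply: (iffP eqP) => [/setP v0 u | noarc].
  by have := v0 u; rewrite !inE => ->.
by apply/setP => u; rewrite !inE (negPf (noarc u)).
Qed.

(** The hypothesis makes S a fixed point of [force_step], so the iteration never leaves S. *)
Lemma stalled_failed S :
  S != [set: D] ->
  (forall v w, v \in S -> out_nbrs v :\: S <> [set w]) ->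
  failed_zero_forcing S.
Proof.
move=> SneT stalled [i].
have stepS : force_step S = S.
  apply/setUidPl/subsetP => w; rewrite inE => /existsP[v /andP[vS /eqP outv]].
  by case: (stalled v w).
suff -> : force_iter i S = S by apply/eqP.
by elim: i => //= i ->.
Qed.

(** An arc from u to v has u in the set, as there are no loops, and v is then the only white
    out-neighbour of u, forced in one step. Without such an arc nothing can force v. *)
Lemma failed_setC1 v : failed_zero_forcing (~: [set v]) <-> in_degree v == 0.
Proof.
split=> [failed | /in_degree_eq0P noarc].
  apply/in_degree_eq0P => u; apply/negP => uv; apply: failed; exists 1.
  have uv_neq : u != v by apply: contraTneq uv => ->; rewrite arc_irrefl.
  apply/setP => w; rewrite !inE; case: eqVneq => //= ->.
  apply/existsP; exists u; rewrite !inE uv_neq /=.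
  by apply/eqP/setP => x; rewrite !inE negbK; case: eqVneq => // ->.
apply: stalled_failed => [|u w _ /setP/(_ w)].
  by apply/eqP => /setP/(_ v); rewrite !inE eqxx.
by rewrite !inE eqxx negbK => /andP[/eqP->]; apply/negP.
Qed.

Lemma leq_failed_number S :
  failed_zero_forcing S -> #|S| <= failed_zero_forcing_number D.
Proof. by move=> failed; apply: leq_bigmax_cond; apply/asboolP. Qed.

(** Only the full vertex set has [#|D|] elements, and it is zero forcing after 0 steps. *)
Lemma failed_card S : failed_zero_forcing S -> #|S| < #|D|.
Proof.
move=> failed; rewrite ltn_neqAle max_card andbT.
apply/negP => /eqP cardS; apply: failed; exists 0.
by apply/eqP; rewrite eqEcard subsetT cardsT cardS leqnn.
Qed.

Lemma card_predn_setC1 S : #|S|.+1 = #|D| -> exists v, S = ~: [set v].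
Proof.
move=> cardS; have /eqP/cards1P[v Sv] : #|~: S| = 1.
  by apply/eqP; rewrite -(eqn_add2l #|S|) cardsC -cardS addn1.
by exists v; rewrite -Sv setCK.
Qed.

Lemma failed_number_in_degree0 :
  [exists v : D, in_degree v == 0] -> failed_zero_forcing_number D = #|D|.-1.
Proof.
move=> /existsP[v v0]; apply/eqP; rewrite eqn_leq; apply/andP; split.
  apply/bigmax_leqP => S /asboolP /failed_card.
  by case: #|D|.
by rewrite -(cardsC1 v) leq_failed_number //; apply/failed_setC1.
Qed.

Lemma failed_number_in_degree_gt0 :
  ~~ [exists v : D, in_degree v == 0] -> failed_zero_forcing_number D <= #|D|.-2.
Proof.
move=> no0; apply/bigmax_leqP => S /asboolP failed.
have ltS := failed_card _ failed.
suff : #|S|.+1 != #|D| by case: #|D| ltS => [|[|n]] //; rewrite ltnS leq_eqVlt eqSS => /orP[->|].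
apply: contra no0 => /eqP/card_predn_setC1[v Sv].
by apply/existsP; exists v; apply/failed_setC1; rewrite -Sv.
Qed.

End ZeroForcing.

Section StarDigraph.
Variables (D : digraph) (c : D).
Hypothesis ugE : forall u v : D, ug_edge u v = (u == c) (+) (v == c).

Lemma star_arc (u v : D) : arc u v -> (u == c) (+) (v == c).
Proof. by move=> uv; rewrite -ugE /ug_edge uv. Qed.

Lemma star_leaf (v : D) : v != c -> leaf v.
Proof.
move=> vc; apply/cards1P; exists c; apply/setP => u; rewrite !inE.
by rewrite -/(ug_edge v u) ugE (negPf vc).
Qed.

Lemma star_in_degree0 :
  oriented D || [exists v : D, leaf v && (in_degree v == 0)] =
  [exists v : D, in_degree v == 0].
Proof.
apply/orP/existsP => [[/forallP ori | /existsP[v /andP[_ v0]]] | [v v0]].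
- have [|] := boolP (in_degree c == 0); first by exists c.
  (* The vertex u is a leaf, so an arc into it could only come from c, against the orientation. *)
  rewrite cards_eq0 => /set0Pn[u]; rewrite inE => uc; exists u.
  apply/in_degree_eq0P => w; apply/negP => wu.
  move: (star_arc _ _ uc) (star_arc _ _ wu); rewrite eqxx addbT => /negPf->.
  rewrite addbF => /eqP wc; rewrite wc in wu.
  by have /forallP/(_ c) := ori u; rewrite uc wu.
- by exists v.
have [vc | vc] := eqVneq v c; last first.
  by right; apply/existsP; exists v; rewrite star_leaf.
(* Of two opposite arcs between u and w, one would enter the centre. *)
left; rewrite {}vc in v0; move/in_degree_eq0P: v0 => noarc.
apply/forallP => u; apply/forallP => w; apply/implyP => uw; apply/negP => wu.
have := star_arc _ _ uw; have [uc|_] := eqVneq u c.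
  by rewrite uc (negPf (noarc w)) in wu.
by move=> /= /eqP wc; rewrite wc (negPf (noarc u)) in uw.
Qed.

Lemma star_failed_number_ge :
  ~~ [exists v : D, in_degree v == 0] -> #|D|.-2 <= failed_zero_forcing_number D.
Proof.
move=> /existsPn no0.
have c_arc v : v != c -> arc c v.
  move=> vc; have := no0 v; rewrite cards_eq0 => /set0Pn[u]; rewrite inE => uv.
  by have := star_arc _ _ uv; rewrite (negPf vc) addbF => /eqP <-.
(* With at most two vertices the bound is 0; otherwise there are two distinct leaves a and b. *)
have [le2 | lt2] := leqP #|D| 2; first by case: #|D| le2 => [|[|[|]]].
have /card_gt1P[a [b [ac bc ab]]] : 1 < #|predC1 c|.
  by rewrite cardC1; case: #|D| lt2.
rewrite !inE in ac bc.
have card_ab : #|~: [set a; b]| = #|D|.-2.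
  by rewrite cardsCs setCK cards2 ab subn2.
rewrite -card_ab; apply: leq_failed_number; apply: stalled_failed => [|v w].
  by apply/eqP => /setP/(_ a); rewrite !inE eqxx.
rewrite !inE => vab out_v; have [vc | vc] := eqVneq v c.
  have /setP/(_ a) := out_v; have /setP/(_ b) := out_v.
  rewrite !inE vc !c_arc // !eqxx orbT /= => /esym/eqP<- /esym.
  by rewrite (negPf ab).
(* A leaf v has no out-neighbour but c, whereas w is a or b. *)
have /setP/(_ w) := out_v; rewrite !inE eqxx negbK => /andP[w_ab vw].
have := star_arc _ _ vw; rewrite (negPf vc) /= => /eqP wc.
by case/orP: w_ab => /eqP wE; [rewrite -wE wc eqxx in ac | rewrite -wE wc eqxx in bc].
Qed.

End StarDigraph.

Theorem theorem4p4 (D : digraph) (t : nat) (t_ge1 : 1 <= t)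
    (UG_star : sgraph_iso (underlying_graph D) (star t)) :
  failed_zero_forcing_number D =
    if oriented D || [exists v : D, leaf v && (in_degree v == 0)] then t
    else t - 1.
Proof.
case: UG_star => f f_bij f_edge.
have cardD : #|D| = t.+1 by rewrite (bij_eq_card f_bij) card_ord.
have [g fK gK] := f_bij.
have f_ord0 (u : D) : (f u == ord0) = (u == g ord0).
  by rewrite -(can_eq gK) fK.
have ugE (u v : D) : ug_edge u v = (u == g ord0) (+) (v == g ord0).
  by rewrite -!f_ord0; apply: f_edge.
rewrite (star_in_degree0 _ _ ugE); case: ifPn => [/failed_number_in_degree0->|no0].
  by rewrite cardD.
(* As [#|D|] is t + 1, the value t - 1 is [#|D|.-2], where both bounds meet. *)
apply/eqP; rewrite subn1 -[t.-1]/(t.+1.-2) -cardD eqn_leq.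
by rewrite failed_number_in_degree_gt0 // (star_failed_number_ge _ _ ugE).
Qed.
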